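(* Let $1\le l<k$ and let nonnegative shifts $\{\lambda_i\}_{i=1}^{k-l}$, $\{\mu_i\}_{i=1}^{k-l}$ satisfy $\lambda_i^2+\mu_i^2=1$. Let $G,P,\bar G$ be the orthogonal matrices accumulated in the $k-l$ implicit QR steps with these shifts described in the context, and let $$B_k^+=G^{\mathrm T}B_kP,\quad V_k^+=V_kP,\quad U_{k+1}^+=U_{k+1}G,\quad \bar B_k^+=\bar G^{\mathrm T}\bar B_kP,\quad \widehat U_k^+=\widehat U_k\bar G .$$ Let $V_l^+,U_{l+1}^+,\widehat U_l^+$ consist of the first $l$, $l+1$, $l$ columns of $V_k^+,U_{k+1}^+,\widehat U_k^+$, and let $B_l^+$, $\bar B_l^+$ be the leading $(l+1)\times l$ and $l\times l$ submatrices of $B_k^+$, $\bar B_k^+$. Define $\alpha_{l+1}^+=e_{l+1}^{\mathrm T}B_k^+e_{l+1}$, $\bar\beta_l^+=e_l^{\mathrm T}\bar B_k^+e_{l+1}$, $v_{l+1}^+=V_k^+e_{l+1}$. Then there is the implicitly restarted $l$-step joint Lanczos bidiagonalization processes of $Q_A$ and $Q_L$ with the shifts $\{\lambda_i\}_{i=1}^{k-l}$ and $\{\mu_i\}_{i=1}^{k-l}$: $$Q_AV_l^+=U_{l+1}^+B_l^+,\qquad Q_A^{\mathrm T}U_{l+1}^+=V_l^+B_l^{+\mathrm T}+r_l^+e_{l+1}^{\mathrm T},$$ $$Q_LV_l^+=\widehat U_l^+\bar B_l^+,\qquad Q_L^{\mathrm T}\widehat U_l^+=V_l^+\bar B_l^{+\mathrm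 T}+\bar r_l^+e_l^{\mathrm T},$$ where $$r_l^+=\alpha_{k+1}\left(e_{k+1}^{\mathrm T}Ge_{l+1}\right)v_{k+1}+\alpha_{l+1}^+v_{l+1}^+,\qquad \bar r_l^+=\bar\beta_k\left(e_k^{\mathrm T}\bar Ge_l\right)v_{k+1}+\bar\beta_l^+v_{l+1}^+$$ (with $U_{l+1}^+,V_l^+,\widehat U_l^+$ having orthonormal columns, $B_l^+$ lower bidiagonal, $\bar B_l^+$ upper bidiagonal, and $r_l^+,\bar r_l^+$ orthogonal to the columns of $V_l^+$), and the updated starting vectors $u_1^+=U_{l+1}^+e_1$ and $v_1^+=V_l^+e_1$ satisfy $$\tau u_1^+=(Q_AQ_A^{\mathrm T}-\lambda_1^2I_m)\cdots(Q_AQ_A^{\mathrm T}-\lambda_{k-l}^2I_m)u_1,$$ $$\rho v_1^+=(Q_A^{\mathrm T}Q_A-\lambda_1^2I_n)\cdots(Q_A^{\mathrm T}Q_A-\lambda_{k-l}^2I_n)v_1$$ with $\tau$ and $\rho$ being (nonzero) normalizing factors.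
   Context: $\|\cdot\|$ is the 2-norm; $e_i$ is the $i$-th column of an identity matrix of appropriate size; exact arithmetic. **Joint Lanczos bidiagonalizations.** $A\in\mathbb{R}^{m\times n}$, $L\in\mathbb{R}^{p\times n}$, $m+p\ge n$, $\operatorname{rank}((A^{\mathrm T},L^{\mathrm T})^{\mathrm T})=n$, with economy QR factorization $\begin{pmatrix}A\\L\end{pmatrix}=\begin{pmatrix}Q_A\\Q_L\end{pmatrix}R$. With unit starting vectors $u_1$ and $\hat v_1=v_1=Q_A^{\mathrm T}u_1/\|Q_A^{\mathrm T}u_1\|$ (no breakdown), $$Q_AV_k=U_{k+1}B_k,\quad Q_A^{\mathrm T}U_{k+1}=V_kB_k^{\mathrm T}+\alpha_{k+1}v_{k+1}e_{k+1}^{\mathrm T},$$ $$Q_L\widehat V_k=\widehat U_k\widehat B_k,\quad Q_L^{\mathrm T}\widehat U_k=\widehat V_k\widehat B_k^{\mathrm T}+\hat\beta_k\hat v_{k+1}e_k^{\mathrm T},$$ where $U_{k+1}=(u_1,\dots,u_{k+1})$, $(V_k,v_{k+1})=(v_1,\dots,v_{k+1})$, $\widehat U_k$, $\widehat V_k=(\hat v_1,\dots,\hat v_k)$ have orthonormal columns, $B_k\in\mathbb{R}^{(k+1)\times k}$ is lower bidiagonal with diagonal $\alpha_1,\dots,\alpha_k$ and subdiagonal $\beta_2,\dots,\beta_{k+1}$, $\widehat B_k\in\mathbb{R}^{k\times k}$ is upper bidiagonal with diagonal $\hat\alpha_1,\dots,\hat\alpha_k$ and superdiagonal $\hat\beta_1,\dots,\hat\beta_{k-1}$,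 and all $\alpha_i,\beta_i,\hat\alpha_i$ are positive. Known facts: $\hat v_{i+1}=(-1)^iv_{i+1}$, $\hat\alpha_i\hat\beta_i=\alpha_{i+1}\beta_{i+1}$ ($i=1,\dots,k$). With $D_k=\operatorname{diag}(1,-1,\dots,(-1)^{k-1})$, $\bar B_k=\widehat B_kD_k$, $\bar\beta_k=(-1)^k\hat\beta_k$, one has $Q_LV_k=\widehat U_k\bar B_k$, $Q_L^{\mathrm T}\widehat U_k=V_k\bar B_k^{\mathrm T}+\bar\beta_kv_{k+1}e_k^{\mathrm T}$ and $B_k^{\mathrm T}B_k+\bar B_k^{\mathrm T}\bar B_k=I_k$. **One implicit QR step with shifts $(\lambda,\mu)$, $\lambda^2+\mu^2=1$**, on a pair $(B,\bar B)$ with $B\in\mathbb{R}^{(k+1)\times k}$ lower bidiagonal, $\bar B\in\mathbb{R}^{k\times k}$ upper bidiagonal, $B^{\mathrm T}B+\bar B^{\mathrm T}\bar B=I_k$. (i) Choose a Givens rotation $G_1$ in the plane $(1,2)$ such that the $(2,1)$-entry of $G_1^{\mathrm T}(BB^{\mathrm T}-\lambda^2I_{k+1})$ is zero; starting from $G_1^{\mathrm T}B$, for $j=1,\dots,k-1$ in turn choose a Givens rotation $P_j$ in the plane $(j,j+1)$, applied on the right, annihilating the $(j,j+1)$-entry, then a Givens rotation $G_{j+1}$ in the plane $(j+1,j+2)$, with $G_{j+1}^{\mathrm T}$ applied on the left, annihilating the $(j+2,j)$-entry. (A rotation is taken to be the identity if the pair of entries it acts on to annihilate is $(0,0)$.)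 (ii) On $\bar B$, perform the analogous bulge chasing for the shift $\mu^2$ on $\bar B^{\mathrm T}\bar B$; since $\bar B^{\mathrm T}\bar B-\mu^2I=-(B^{\mathrm T}B-\lambda^2I)$, its right rotations are the same $P_j$: for $j=1,\dots,k-1$ in turn apply $P_j$ on the right and then $\bar G_j^{\mathrm T}$ on the left, where $\bar G_j$ is a Givens rotation in the plane $(j,j+1)$ annihilating the $(j+1,j)$-entry. The step produces $G_1\cdots G_k$, $P_1\cdots P_{k-1}$, $\bar G_1\cdots\bar G_{k-1}$. **Multi-step.** Perform $k-l$ such steps in turn, starting from $(B_k,\bar B_k)$, the $i$-th with shifts $(\lambda_i,\mu_i)$, yielding $G^{(i)},P^{(i)},\bar G^{(i)}$ and replacing the current pair $(B,\bar B)$ by $(G^{(i)\mathrm T}BP^{(i)},\bar G^{(i)\mathrm T}\bar BP^{(i)})$. Set $G=G^{(1)}\cdots G^{(k-l)}$, $P=P^{(1)}\cdots P^{(k-l)}$, $\bar G=\bar G^{(1)}\cdots\bar G^{(k-l)}$. *)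

(* Defs.v *)
From HB Require Import structures.
From mathcomp Require Import all_boot all_order all_algebra.
From mathcomp Require Import reals.

Set Implicit Arguments.
Unset Strict Implicit.
Unset Printing Implicit Defensive.

Import Order.TTheory GRing.Theory Num.Theory.

Local Open Scope ring_scope.

(* Row, column and plane indices given as natural numbers are 1-based
   throughout. *)

(* [evec i] is e_i; it is 0 unless 1 <= i <= n. *)
Definition evec (R : realType) (n i : nat) : 'cV[R]_n :=
  \col_(a < n) (a.+1 == i)%:R.
Arguments evec {R n} i.

(* e_i^T M e_j *)
Definition entry (R : realType) (m n : nat) (M : 'M[R]_(m, n)) (i j : nat) : R :=
  ((evec i)^T *m M *m evec j) 0 0.

Definition norm2 (R : realType) (n : nat) (x : 'cV[R]_n) : R :=
  Num.sqrt (\sum_(i < n) x i 0 ^+ 2).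

Definition orthonormal_cols (R : realType) (m n : nat) (M : 'M[R]_(m, n)) : Prop :=
  M^T *m M = 1%:M.

Definition lower_bidiagonal (R : realType) (m n : nat) (M : 'M[R]_(m, n)) : Prop :=
  forall (i : 'I_m) (j : 'I_n), i != j :> nat -> i != j.+1 :> nat -> M i j = 0.

Definition upper_bidiagonal (R : realType) (m n : nat) (M : 'M[R]_(m, n)) : Prop :=
  forall (i : 'I_m) (j : 'I_n), i != j :> nat -> j != i.+1 :> nat -> M i j = 0.

Definition lead_cols (R : realType) (m n q : nat) (hq : (q <= n)%N)
    (M : 'M[R]_(m, n)) : 'M[R]_(m, q) :=
  colsub (widen_ord hq) M.

Definition lead_mx (R : realType) (m n p q : nat) (hp : (p <= m)%N) (hq : (q <= n)%N)
    (M : 'M[R]_(m, n)) : 'M[R]_(p, q) :=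
  mxsub (widen_ord hp) (widen_ord hq) M.

(* (k+1) x k, diagonal alpha_1, ..., alpha_k, subdiagonal
   beta_2, ..., beta_{k+1}. *)
Definition lower_bidiag_mx (R : realType) (k : nat) (alpha beta : nat -> R) :
    'M[R]_(k.+1, k) :=
  \matrix_(i < k.+1, j < k)
    if i == j :> nat then alpha j.+1
    else if i == j.+1 :> nat then beta j.+2 else 0.

(* k x k, diagonal alpha_1, ..., alpha_k, superdiagonal
   beta_1, ..., beta_{k-1}. *)
Definition upper_bidiag_mx (R : realType) (k : nat) (alpha beta : nat -> R) :
    'M[R]_k :=
  \matrix_(i < k, j < k)
    if i == j :> nat then alpha i.+1
    else if j == i.+1 :> nat then beta i.+1 else 0.

(* diag(1, -1, ..., (-1)^(k-1)) *)
Definition alt_diag_mx (R : realType) (k : nat) : 'M[R]_k :=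
  diag_mx (\row_(j < k) (-1) ^+ j).
Arguments alt_diag_mx {R} k.

Record economy_QR (R : realType) (m p n : nat)
    (A : 'M[R]_(m, n)) (L : 'M[R]_(p, n))
    (QA : 'M[R]_(m, n)) (QL : 'M[R]_(p, n)) (T : 'M[R]_n) : Prop := EconomyQR {
  qr_factor : col_mx A L = col_mx QA QL *m T;
  qr_orth : orthonormal_cols (col_mx QA QL);
  qr_upper : forall i j : 'I_n, (j < i)%N -> T i j = 0
}.

(* The k-step joint Lanczos bidiagonalizations of QA and QL.  [v] and [vh] are
   the (k+1)-st vectors v_{k+1} and \hat v_{k+1}, which are not columns of [V]
   and [Vh]. *)
Record joint_lanczos (R : realType) (m p n k : nat)
    (QA : 'M[R]_(m, n)) (QL : 'M[R]_(p, n))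
    (alpha beta alphah betah : nat -> R)
    (U : 'M[R]_(m, k.+1)) (V : 'M[R]_(n, k)) (v : 'cV[R]_n)
    (Uh : 'M[R]_(p, k)) (Vh : 'M[R]_(n, k)) (vh : 'cV[R]_n) : Prop :=
  JointLanczos {
  jl_start : V *m evec 1 =
    (norm2 (QA^T *m (U *m evec 1)))^-1 *: (QA^T *m (U *m evec 1));
  jl_starth : Vh *m evec 1 = V *m evec 1;
  jl_A : QA *m V = U *m lower_bidiag_mx k alpha beta;
  jl_AT : QA^T *m U = V *m (lower_bidiag_mx k alpha beta)^T
                      + alpha k.+1 *: (v *m (evec k.+1)^T);
  jl_L : QL *m Vh = Uh *m upper_bidiag_mx k alphah betah;
  jl_LT : QL^T *m Uh = Vh *m (upper_bidiag_mx k alphah betah)^T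
                       + betah k *: (vh *m (evec k)^T);
  jl_U : orthonormal_cols U;
  jl_V : orthonormal_cols (row_mx V v);
  jl_Uh : orthonormal_cols Uh;
  jl_Vh : orthonormal_cols Vh;
  jl_alpha : forall i : nat, (1 <= i <= k.+1)%N -> 0 < alpha i;
  jl_beta : forall i : nat, (2 <= i <= k.+1)%N -> 0 < beta i;
  jl_alphah : forall i : nat, (1 <= i <= k)%N -> 0 < alphah i;
  (* The known sign relations between the two processes. *)
  jl_sign : forall i : nat, (1 <= i < k)%N ->
    Vh *m evec i.+1 = (-1) ^+ i *: (V *m evec i.+1);
  jl_sign_last : vh = (-1) ^+ k *: v;
  jl_prod : forall i : nat, (1 <= i <= k)%N ->
    alphah i * betah i = alpha i.+1 * beta i.+1
}.

(* Rotation matrix acting in the plane (p, p+1); the two coordinates are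
   a.+1 = p and a = p for the 0-based ordinal a. *)
Definition givens (R : realType) (n p : nat) (c s : R) : 'M[R]_n :=
  \matrix_(a < n, b < n)
    if (a.+1 == p) && (b.+1 == p) || (a == p :> nat) && (b == p :> nat) then c
    else if (a.+1 == p) && (b == p :> nat) then s
    else if (a == p :> nat) && (b.+1 == p) then - s
    else (a == b)%:R.
Arguments givens {R} n p c s.

Definition is_givens (R : realType) (n p : nat) (G : 'M[R]_n) : Prop :=
  exists c s : R, c ^+ 2 + s ^+ 2 = 1 /\ G = givens n p c s.

(* G is a rotation in the plane (p, p+1) such that G^T M has a zero
   (p+1, j)-entry.  The rotation is only determined up to sign, hence a
   relation. *)
Definition left_annihilates (R : realType) (m n : nat) (M : 'M[R]_(m, n))
    (p j : nat) (G : 'M[R]_m) : Prop :=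
  [/\ is_givens p G,
      entry (G^T *m M) p.+1 j = 0
    & entry M p j = 0 -> entry M p.+1 j = 0 -> G = 1%:M].

(* P is a rotation in the plane (p, p+1) such that M P has a zero
   (i, p+1)-entry. *)
Definition right_annihilates (R : realType) (m n : nat) (M : 'M[R]_(m, n))
    (i p : nat) (P : 'M[R]_n) : Prop :=
  [/\ is_givens p P,
      entry (M *m P) i p.+1 = 0
    & entry M i p = 0 -> entry M i p.+1 = 0 -> P = 1%:M].

(* One implicit QR step with shift lambda on the pair (B, Bb), where [Gr], [Pr]
   and [Gbr] list the elementary rotations G_1, ..., G_k, P_1, ..., P_{k-1} and
   \bar G_1, ..., \bar G_{k-1}.  The matrix to which a rotation is applied is
   written with all the previous rotations spelled out.  The shift mu does not
   occur: it enters only through lambda^2 + mu^2 = 1, the right rotations on Bb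
   being those found on B. *)
Definition qr_rotations (R : realType) (k : nat) (lambda : R)
    (B : 'M[R]_(k.+1, k)) (Bb : 'M[R]_k)
    (Gr : nat -> 'M[R]_k.+1) (Pr Gbr : nat -> 'M[R]_k) : Prop :=
  left_annihilates (B *m B^T - (lambda ^+ 2)%:M) 1 1 (Gr 1%N)
  /\ forall j : nat, (1 <= j < k)%N ->
     [/\ right_annihilates
           ((\prod_(1 <= i < j.+1) Gr i)^T *m B *m \prod_(1 <= i < j) Pr i)
           j j (Pr j),
         left_annihilates
           ((\prod_(1 <= i < j.+1) Gr i)^T *m B *m \prod_(1 <= i < j.+1) Pr i)
           j.+1 j (Gr j.+1)
       & left_annihilates
           ((\prod_(1 <= i < j) Gbr i)^T *m Bb *m \prod_(1 <= i < j.+1) Pr i)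
           j j (Gbr j)].

Definition qr_step (R : realType) (k : nat) (lambda : R)
    (B : 'M[R]_(k.+1, k)) (Bb : 'M[R]_k)
    (G : 'M[R]_k.+1) (P Gb : 'M[R]_k) : Prop :=
  exists (Gr : nat -> 'M[R]_k.+1) (Pr Gbr : nat -> 'M[R]_k),
    [/\ qr_rotations lambda B Bb Gr Pr Gbr,
        G = \prod_(1 <= j < k.+1) Gr j,
        P = \prod_(1 <= j < k) Pr j
      & Gb = \prod_(1 <= j < k) Gbr j].

(* N steps in turn, the i-th with shift lambda i: [qr_pair] is the current pair
   after the first i steps. *)
Fixpoint qr_pair (R : realType) (k : nat) (B : 'M[R]_(k.+1, k)) (Bb : 'M[R]_k)
    (Gs : nat -> 'M[R]_k.+1) (Ps Gbs : nat -> 'M[R]_k) (i : nat) :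
    'M[R]_(k.+1, k) * 'M[R]_k :=
  if i is i'.+1 then
    let BB := qr_pair B Bb Gs Ps Gbs i' in
    ((Gs i)^T *m BB.1 *m Ps i, (Gbs i)^T *m BB.2 *m Ps i)
  else (B, Bb).

Definition qr_steps (R : realType) (k N : nat) (lambda : nat -> R)
    (B : 'M[R]_(k.+1, k)) (Bb : 'M[R]_k)
    (Gs : nat -> 'M[R]_k.+1) (Ps Gbs : nat -> 'M[R]_k) : Prop :=
  forall i : nat, (1 <= i <= N)%N ->
    qr_step (lambda i) (qr_pair B Bb Gs Ps Gbs i.-1).1
      (qr_pair B Bb Gs Ps Gbs i.-1).2 (Gs i) (Ps i) (Gbs i).

(* Main.v *)
Require Import Defs.
From HB Require Import structures.
From mathcomp Require Import all_boot all_order all_algebra.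
From mathcomp Require Import reals.
From mathcomp Require Import zify ring.

Set Implicit Arguments.
Unset Strict Implicit.
Unset Printing Implicit Defensive.

Import Order.TTheory GRing.Theory Num.Theory.

Local Open Scope ring_scope.

(** The bulge chase is purely structural: it keeps B lower bidiagonal and Bb
    upper triangular, whether or not a shift deflates.  That Bb stays bidiagonal
    then follows from Bb^T Bb = I - B^T B being tridiagonal and Bb invertible.
    A product of N steps only fills G and Gb down to the N-th subdiagonal, so
    truncating the transformed recurrences with N = k - l leaves a remainder in
    the last column only.
    Each step maps e_1 to a multiple of (B B^T - lambda^2 I) e_1, so that
    prod (B B^T - lambda_i^2 I) e_1 = tau G e_1; the left side is nonzero because
    B B^T is tridiagonal with nonzero subdiagonal and N <= k.  Multiplying by B^T,
    whose first column is alpha_1 e_1, gives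
    alpha_1 prod (B^T B - lambda_i^2 I) e_1 = tau alpha_1^+ P e_1, again nonzero,
    and as N < k the Krylov relations carry both identities over to Q_A. *)

(** * Entries, columns and single Givens rotations *)

(* The entry (a, b), with a and b 0-based, of a rotation in the plane (p, p+1) may
   be nonzero. *)
Definition same_plane (p a b : nat) : Prop :=
  a = b \/ (a.+1 = p \/ a = p) /\ (b.+1 = p \/ b = p).

Lemma entryE (R : realType) m n (M : 'M[R]_(m, n)) i j (a : 'I_m) (b : 'I_n) :
  a.+1 = i -> b.+1 = j -> entry M i j = M a b.
Proof.
move=> <- <-; rewrite /entry mxE (bigD1 b) //= big1 => [|c ncb].
  rewrite mxE (bigD1 a) //= big1 => [|c nca].
    by rewrite !mxE !eqxx mul1r mulr1 !addr0.
  by rewrite !mxE eqSS (inj_eq val_inj) (negPf nca) mul0r.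
by rewrite !mxE eqSS (inj_eq val_inj) (negPf ncb) mulr0.
Qed.

Lemma mulmx_evec (R : realType) m n (M : 'M[R]_(m, n)) i (b : 'I_n) :
  b.+1 = i -> M *m evec i = col b M.
Proof.
move=> <-; apply/colP => a; rewrite !mxE (bigD1 b) //= big1 => [|c ncb].
  by rewrite !mxE eqxx mulr1 addr0.
by rewrite !mxE eqSS (inj_eq val_inj) (negPf ncb) mulr0.
Qed.

Lemma givens_eq0 (R : realType) n p (G : 'M[R]_n) (a b : 'I_n) :
  is_givens p G -> ~ same_plane p a b -> G a b = 0.
Proof.
move=> [c [s [_ ->]]] nab; rewrite mxE.
rewrite (_ : (a == b) = (a == b :> nat)) //.
by repeat (case: ifP; [rewrite /same_plane in nab; lia | move=> _]);
  case: eqP => // ab; case: nab; left.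
Qed.

Lemma mulmx_givens_eq0 (R : realType) m n p (M : 'M[R]_(m, n)) (G : 'M[R]_n)
    (a : 'I_m) (b : 'I_n) : is_givens p G ->
  (forall c : 'I_n, same_plane p c b -> M a c = 0) -> (M *m G) a b = 0.
Proof.
move=> Gp M0; rewrite mxE big1 // => c _.
have [/M0->|/givens_eq0->//] : same_plane p c b \/ ~ same_plane p c b.
- by rewrite /same_plane; lia.
- by rewrite mul0r.
- by rewrite mulr0.
Qed.

Lemma givens_tr_mulmx_eq0 (R : realType) m n p (M : 'M[R]_(m, n)) (G : 'M[R]_m)
    (a : 'I_m) (b : 'I_n) : is_givens p G ->
  (forall c : 'I_m, same_plane p c a -> M c b = 0) -> (G^T *m M) a b = 0.
Proof.
move=> Gp M0; rewrite -[_ *m _]trmxK trmx_mul trmxK mxE.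
by apply: (mulmx_givens_eq0 Gp) => c /M0; rewrite mxE.
Qed.

(** Outside its plane the matrix is the identity, so only a 2 by 2 block matters, where c^2 + s^2 =
    1 is used. The bounds on p keep both coordinates of the plane inside the matrix. *)
Lemma givens_orth (R : realType) n p (G : 'M[R]_n) :
  is_givens p G -> (1 <= p < n)%N -> G^T *m G = 1%:M.
Proof.
case: p => // p [c [s [cs1 ->]]] /= p_lt.
pose i0 : 'I_n := Ordinal (ltnW p_lt); pose i1 : 'I_n := Ordinal p_lt.
have ne10 : (i1 == i0) = false by rewrite -val_eqE /= eqn_leq ltnn.
have ne01 : (i0 == i1) = false by rewrite eq_sym.
have GE (x y : 'I_n) : givens n p.+1 c s x y =
    if x == i0 then (if y == i0 then c else if y == i1 then s else 0)
    else if x == i1 then (if y == i0 then - s else if y == i1 then c else 0)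
    else (x == y)%:R.
  rewrite mxE !eqSS -[(x : nat) == p]/(x == i0) -[(x : nat) == p.+1]/(x == i1).
  rewrite -[(y : nat) == p]/(y == i0) -[(y : nat) == p.+1]/(y == i1).
  have [->|nx0] := eqVneq x i0.
    rewrite ne01 /= orbF; case: eqP => // /eqP/negPf ny0.
    by case: ifP => // _; rewrite [i0 == y]eq_sym ny0.
  have [->|nx1] := eqVneq x i1; last by [].
  rewrite /=; case: eqP => [->|/eqP/negPf ny1]; first by rewrite ne10.
  by case: ifP => // _; rewrite [i1 == y]eq_sym ny1.
apply/matrixP => a b; rewrite [RHS]mxE [LHS]mxE (bigD1 i0) //= (bigD1 i1) ?ne10 //=.
(* A row outside the plane is a row of the identity, hence contributes only when x = a = b. *)
rewrite (eq_bigr (fun x => ((x == a) && (x == b))%:R)); last first.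
  move=> x /andP[/negPf nx0 /negPf nx1]; rewrite [_^T _ _]mxE !GE nx0 nx1.
  by case: eqP; case: eqP; rewrite ?mul0r ?mulr0 ?mulr1.
rewrite ![_^T _ _]mxE !GE eqxx ne10 eqxx.
have [aP|aP] := boolP ((a != i0) && (a != i1)).
  rewrite (bigD1 a) //= big1 => [|x /andP[_ /negPf->]//].
  case/andP: aP => /negPf-> /negPf->.
  by rewrite eqxx !mul0r !add0r addr0.
rewrite big1 => [|x xP]; last by case: eqP => // xa; rewrite -xa xP in aP.
move: aP; rewrite negb_and !negbK => /orP[]/eqP->;
  rewrite !eqxx ?ne10 ?[_ == b]eq_sym.
  case: (b =P i0) => _; first by rewrite -cs1 /=; ring.
  by case: (b =P i1) => _ /=; ring.
case: (b =P i1) => [->|_]; first by rewrite ne10 -cs1 /=; ring.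
by case: (b =P i0) => _ /=; ring.
Qed.

(** * Products of rotations: orthogonality and bandwidth *)

Lemma prod_orth (R : realType) n N (F : nat -> 'M[R]_n) :
  (forall i, (1 <= i < N)%N -> (F i)^T *m F i = 1%:M) ->
  (\prod_(1 <= i < N) F i)^T *m \prod_(1 <= i < N) F i = 1%:M.
Proof.
move=> Fo; rewrite big_nat.
apply: (big_ind (fun X : 'M[R]_n => X^T *m X = 1%:M)) => [|X Y Xo Yo|i /Fo//].
  by rewrite trmx1 mulmx1.
by rewrite -mulmxE trmx_mul mulmxA -(mulmxA Y^T) Xo mulmx1.
Qed.

(** N counts the permitted subdiagonals: 0 means upper triangular, 1 upper Hessenberg. For a
    symmetric matrix, N = 1 means tridiagonal. *)
Definition upper_band (R : realType) (m n N : nat) (M : 'M[R]_(m, n)) : Prop :=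
  forall (a : 'I_m) (b : 'I_n), (b + N < a)%N -> M a b = 0.

(** The induction also records that after j factors the columns from j on (0-based) are still zero
    below the diagonal. The next factor combines columns j and j+1, so it fills at most the entry
    (j+1, j) there. *)
Lemma prod_givens_hessenberg (R : realType) n N (F : nat -> 'M[R]_n) :
  (forall i, (1 <= i < N)%N -> is_givens i (F i)) ->
  upper_band 1 (\prod_(1 <= i < N) F i).
Proof.
move=> Fg.
suff H j : (j < N)%N -> forall a b : 'I_n,
    (b + 1 < a)%N \/ (j <= b < a)%N -> (\prod_(1 <= i < j.+1) F i) a b = 0.
  case: N Fg H => [|N] Fg H a b ab; last by apply: (H N) => //; left.
  by rewrite big_geq // mxE; case: eqP => // e; rewrite e in ab; lia.
elim: j => [|j IH] jN a b ab.
  by rewrite big_geq // mxE; case: eqP => // e; rewrite e in ab; lia.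
rewrite big_nat_recr //= -mulmxE.
apply: mulmx_givens_eq0 (Fg j.+1 _) _ => [|c cb]; first by lia.
by apply: IH; [lia | rewrite /same_plane in cb; lia].
Qed.

Lemma prod_upper_band (R : realType) n N (F : nat -> 'M[R]_n) :
  (forall i, (1 <= i < N.+1)%N -> upper_band 1 (F i)) ->
  upper_band N (\prod_(1 <= i < N.+1) F i).
Proof.
elim: N => [|N IH] Fb a b ab.
  by rewrite big_geq // mxE; case: eqP => // e; rewrite e in ab; lia.
rewrite big_nat_recr //= -mulmxE mxE big1 // => c _.
have [cb|bc] := ltnP (b + 1) c; first by rewrite (Fb N.+1) ?mulr0 //; lia.
rewrite IH ?mul0r //; last by lia.
by move=> i iN; apply: Fb; lia.
Qed.

(** * Bulge chasing *)

(* The bulge created by G_{j+1} sits at the 1-based entry (j+1, j+2), hence the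
   single exceptional entry in the invariant [H]. *)
Lemma chase_lower_bidiagonal (R : realType) k lambda (B : 'M[R]_(k.+1, k))
    Bb Gr Pr Gbr : (0 < k)%N ->
  lower_bidiagonal B -> qr_rotations lambda B Bb Gr Pr Gbr ->
  lower_bidiagonal ((\prod_(1 <= j < k.+1) Gr j)^T *m B *m
                    \prod_(1 <= j < k) Pr j).
Proof.
case: k B Bb Gr Pr Gbr => // k B Bb Gr Pr Gbr _ Bl [[G1 _ _] chase].
pose M j := (\prod_(1 <= i < j.+2) Gr i)^T *m B *m \prod_(1 <= i < j.+1) Pr i.
suff H j : (j <= k)%N -> forall (a : 'I_k.+2) (b : 'I_k.+1),
    a != b :> nat -> a != b.+1 :> nat -> ~ (a = j :> nat /\ b = j.+1 :> nat) ->
    M j a b = 0.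
  (* At the end of the chase the exceptional column falls outside the matrix, so no bulge is
     left. *)
  by move=> a b ab ab1; apply: (H k) => // -[_ bk]; have := ltn_ord b; lia.
elim: j => [|j IH] jk.
  move=> a b ab ab1 ab2; rewrite /M big_nat1 [X in _ *m X]big_geq // mulmx1.
  apply: (givens_tr_mulmx_eq0 G1) => c ca.
  by apply: Bl; rewrite /same_plane in ca; lia.
have [[Pg P0 _] [Gg G0 _] _] := chase j.+1 ltac:(lia).
(* [N] is the state between the two rotations: the right one has moved the bulge to the 0-based
   entry (j+2, j), from where the left one sends it back above the diagonal. *)
pose N := M j *m Pr j.+1.
have NE : (\prod_(1 <= i < j.+2) Gr i)^T *m B *m \prod_(1 <= i < j.+2) Pr i = N.
  by rewrite /N /M [\prod_(1 <= i < j.+2) Pr i]big_nat_recr //= -mulmxE !mulmxA.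
have ME : M j.+1 = (Gr j.+2)^T *m N.
  rewrite /N /M [\prod_(1 <= i < j.+3) _]big_nat_recr //=.
  rewrite [\prod_(1 <= i < j.+2) Pr i]big_nat_recr //= -!mulmxE.
  by rewrite trmx_mul !mulmxA.
rewrite NE -ME in G0.
have N0 (a : 'I_k.+2) (b : 'I_k.+1) :
    a != b :> nat -> a != b.+1 :> nat -> ~ (a = j.+2 :> nat /\ b = j :> nat) ->
    N a b = 0.
  move=> ab ab1 ab2.
  have [[aj bj]|abj] : (a = j :> nat /\ b = j.+1 :> nat)
    \/ ~ (a = j :> nat /\ b = j.+1 :> nat) by lia.
    by rewrite -P0; symmetry; apply: entryE; congr _.+1.
  apply: (mulmx_givens_eq0 Pg) => c cb.
  by apply: IH; rewrite /same_plane in cb; lia.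
move=> a b ab ab1 ab2.
have [[aj bj]|abj] : (a = j.+2 :> nat /\ b = j :> nat)
    \/ ~ (a = j.+2 :> nat /\ b = j :> nat) by lia.
  by rewrite -G0; symmetry; apply: entryE; congr _.+1.
rewrite ME; apply: (givens_tr_mulmx_eq0 Gg) => c ca.
by apply: N0; rewrite /same_plane in ca; lia.
Qed.

(** Below the diagonal, P_j fills only the entry (j+1, j), which the left rotation removes. Fill
    above the superdiagonal is not tracked here; it is excluded later through the Gram matrix. *)
Lemma chase_upper_triangular (R : realType) k lambda (B : 'M[R]_(k.+1, k))
    Bb Gr Pr Gbr : (0 < k)%N ->
  upper_band 0 Bb -> qr_rotations lambda B Bb Gr Pr Gbr ->
  upper_band 0 ((\prod_(1 <= j < k) Gbr j)^T *m Bb *m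
                \prod_(1 <= j < k) Pr j).
Proof.
case: k B Bb Gr Pr Gbr => // k B Bb Gr Pr Gbr _ Bu [_ chase].
pose M j := (\prod_(1 <= i < j.+1) Gbr i)^T *m Bb *m \prod_(1 <= i < j.+1) Pr i.
suff H j : (j <= k)%N -> upper_band 0 (M j) by exact: (H k).
elim: j => [|j IH] jk.
  by rewrite /M !big_geq // trmx1 mul1mx mulmx1.
have [[Pg _ _] _ [Gg G0 _]] := chase j.+1 ltac:(lia).
have {IH} := IH ltac:(lia) => IH.
pose N := M j *m Pr j.+1.
have NE : (\prod_(1 <= i < j.+1) Gbr i)^T *m Bb *m \prod_(1 <= i < j.+2) Pr i = N.
  by rewrite /N /M [\prod_(1 <= i < j.+2) Pr i]big_nat_recr //= -mulmxE !mulmxA.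
have ME : M j.+1 = (Gbr j.+1)^T *m N.
  rewrite /N /M [\prod_(1 <= i < j.+2) Gbr i]big_nat_recr //=.
  rewrite [\prod_(1 <= i < j.+2) Pr i]big_nat_recr //= -!mulmxE.
  by rewrite trmx_mul !mulmxA.
rewrite NE -ME in G0.
have N0 (a b : 'I_k.+1) :
    (b < a)%N -> ~ (a = j.+1 :> nat /\ b = j :> nat) -> N a b = 0.
  move=> ab ab2; apply: (mulmx_givens_eq0 Pg) => c cb.
  by apply: IH; rewrite /same_plane in cb; lia.
move=> a b ab; rewrite addn0 in ab.
have [[aj bj]|abj] : (a = j.+1 :> nat /\ b = j :> nat)
    \/ ~ (a = j.+1 :> nat /\ b = j :> nat) by lia.
  by rewrite -G0; symmetry; apply: entryE; congr _.+1.
rewrite ME; apply: (givens_tr_mulmx_eq0 Gg) => c ca.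
by apply: N0; rewrite /same_plane in ca; lia.
Qed.

(** * The action of a step on e_1 *)

Lemma evec1_eq0 (R : realType) n (a : 'I_n) : (0 < a)%N -> evec 1 a 0 = 0 :> R.
Proof. by rewrite mxE eqSS; case: (a : nat). Qed.

Lemma givens_evec1 (R : realType) n p (G : 'M[R]_n) :
  is_givens p G -> (1 < p)%N -> G *m evec 1 = evec 1.
Proof.
case: n G => [|n] G [c [s [_ ->]]] p1; first by rewrite [LHS]flatmx0 [RHS]flatmx0.
rewrite (@mulmx_evec _ _ _ _ _ ord0) //; apply/colP => a; rewrite !mxE /=.
repeat (case: ifP => ?; first by exfalso; lia).
by rewrite eqSS.
Qed.

(** Rotations in the planes (2,3), (3,4), ... fix e_1. *)
Lemma prod_givens_evec1 (R : realType) n N (F : nat -> 'M[R]_n) :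
  (forall i, (1 <= i < N)%N -> is_givens i (F i)) -> (1 < N)%N ->
  \prod_(1 <= i < N) F i *m evec 1 = F 1%N *m evec 1.
Proof.
move=> Fg N1; rewrite big_ltn //= -mulmxE -mulmxA; congr (_ *m _).
rewrite big_nat.
apply: (big_ind (fun X : 'M[R]_n => X *m evec 1 = evec 1)) => [|X Y X1 Y1|i iN].
- by rewrite mul1mx.
- by rewrite -mulmxA Y1.
- by apply: (@givens_evec1 _ _ i); [apply: Fg; lia | lia].
Qed.

(** The first column of B B^T - lambda^2 I is supported on its first two entries and G^T annihilates
    the second, so a multiple of e_1 remains. The factor gamma is the (1,1)-entry of the rotated
    matrix and may be zero. *)
Lemma qr_first_rotation (R : realType) k lambda (B : 'M[R]_(k.+1, k)) G :
  (0 < k)%N -> lower_bidiagonal B ->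
  left_annihilates (B *m B^T - (lambda ^+ 2)%:M) 1 1 G ->
  exists gamma, (B *m B^T - (lambda ^+ 2)%:M) *m evec 1 = gamma *: (G *m evec 1).
Proof.
move=> k0 Bl [Gg G0 _]; set S := B *m B^T - _ in G0 *.
have Go : G *m G^T = 1%:M by apply/mulmx1C/(givens_orth Gg).
exists ((G^T *m S) 0 0); rewrite scalemxAr.
have -> : S *m evec 1 = G *m (G^T *m S *m evec 1) by rewrite !mulmxA Go mul1mx.
congr (G *m _).
rewrite (@mulmx_evec _ _ _ _ _ ord0) //; apply/colP => a.
rewrite [LHS]mxE [RHS]mxE [evec 1 a 0]mxE.
have [-> | a0] := eqVneq a 0; first by rewrite eqxx mulr1.
have {}a0 : (0 < a)%N by rewrite lt0n.
rewrite eqSS eqn0Ngt a0 mulr0.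
have [a1 | a1] := eqVneq (a : nat) 1%N.
  by rewrite -G0; symmetry; apply: entryE => //; rewrite a1.
apply: (givens_tr_mulmx_eq0 Gg) => c ca.
have c1 : (1 < c)%N by rewrite /same_plane in ca; lia.
rewrite mxE [X in _ + X]mxE [X in _ - X]mxE; case: eqP => [c0|_].
  by rewrite c0 in c1.
rewrite mulr0n subr0 mxE big1 // => x _; rewrite [_^T _ _]mxE.
have [x0|x0] := eqVneq (x : nat) 0%N.
  by rewrite Bl ?mul0r //; lia.
by rewrite (Bl 0) ?mulr0 //=; lia.
Qed.

(** * One step, and several steps in turn *)

Lemma qr_stepP (R : realType) k lambda (B : 'M[R]_(k.+1, k)) Bb G P Gb :
  (0 < k)%N -> lower_bidiagonal B -> upper_band 0 Bb ->
  qr_step lambda B Bb G P Gb ->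
  [/\ [/\ G^T *m G = 1%:M, P^T *m P = 1%:M & Gb^T *m Gb = 1%:M],
      upper_band 1 G /\ upper_band 1 Gb,
      lower_bidiagonal (G^T *m B *m P),
      upper_band 0 (Gb^T *m Bb *m P)
    & exists gamma,
        (B *m B^T - (lambda ^+ 2)%:M) *m evec 1 = gamma *: (G *m evec 1)].
Proof.
move=> k0 Bl Bu [Gr [Pr [Gbr [rots -> -> ->]]]].
have Bl' := chase_lower_bidiagonal k0 Bl rots.
have Bu' := chase_upper_triangular k0 Bu rots.
case: rots => first chase.
have Grg i : (1 <= i < k.+1)%N -> is_givens i (Gr i).
  case: i => // -[_|i ik]; first by case: first.
  by have [_ [] //] := chase i.+1 ltac:(lia).
have Prg i : (1 <= i < k)%N -> is_givens i (Pr i) by move=> /chase[[]].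
have Gbrg i : (1 <= i < k)%N -> is_givens i (Gbr i) by move=> /chase[_ _ []].
split=> //.
- split; apply: prod_orth => i ik.
  + by apply: (givens_orth (Grg _ ik)).
  + by apply: (givens_orth (Prg _ ik)).
  + by apply: (givens_orth (Gbrg _ ik)).
- by split; apply: prod_givens_hessenberg.
- rewrite prod_givens_evec1 //; exact: qr_first_rotation.
Qed.

Lemma qr_pairE (R : realType) k (B : 'M[R]_(k.+1, k)) Bb Gs Ps Gbs N :
  qr_pair B Bb Gs Ps Gbs N =
    ((\prod_(1 <= i < N.+1) Gs i)^T *m B *m \prod_(1 <= i < N.+1) Ps i,
     (\prod_(1 <= i < N.+1) Gbs i)^T *m Bb *m \prod_(1 <= i < N.+1) Ps i).
Proof.
elim: N => [|N IH]; first by rewrite !big_geq //= !trmx1 !mul1mx !mulmx1.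
rewrite /= {}IH [X in _ = (X^T *m _ *m _, _)]big_nat_recr //=.
rewrite [X in _ = (_ *m X, _)]big_nat_recr //=.
rewrite [X in _ = (_, X^T *m _ *m _)]big_nat_recr //=.
rewrite [X in _ = (_, _ *m X)]big_nat_recr //=.
by rewrite -!mulmxE !trmx_mul !mulmxA.
Qed.

Lemma qr_steps_shape (R : realType) k N lambda (B : 'M[R]_(k.+1, k)) Bb Gs Ps Gbs :
  (0 < k)%N -> lower_bidiagonal B -> upper_band 0 Bb ->
  qr_steps N lambda B Bb Gs Ps Gbs ->
  forall i, (i <= N)%N ->
    lower_bidiagonal (qr_pair B Bb Gs Ps Gbs i).1
    /\ upper_band 0 (qr_pair B Bb Gs Ps Gbs i).2.
Proof.
move=> k0 Bl Bu steps; elim=> [|i IH] iN //.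
have [Bl' Bu'] := IH (ltnW iN).
by have [] := qr_stepP k0 Bl' Bu' (steps i.+1 iN).
Qed.

(** * Shift polynomials applied to e_1 *)

Definition shift_prod (R : realType) n (M : 'M[R]_n) (lambda : nat -> R) N :=
  \prod_(1 <= i < N.+1) (M - (lambda i ^+ 2)%:M).

Lemma shift_prod0 (R : realType) n (M : 'M[R]_n) lambda :
  shift_prod M lambda 0 = 1%:M.
Proof. by rewrite /shift_prod big_geq. Qed.

(** The big product gains its new factor on the right. The factors are polynomials in one matrix and
    commute, so the factor may be moved to the left, where the inductions on vectors need it. *)
Lemma shift_prodS (R : realType) n (M : 'M[R]_n) lambda N :
  shift_prod M lambda N.+1 =
    (M - (lambda N.+1 ^+ 2)%:M) *m shift_prod M lambda N.
Proof.
rewrite /shift_prod big_nat_recr //= mulmxE.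
apply/esym/commr_prod => i _; rewrite /GRing.comm -!mulmxE.
rewrite !mulmxBl !mulmxBr !mul_scalar_mx !mul_mx_scalar !scale_scalar_mx mulrC.
by rewrite !opprB addrACA [RHS]addrACA; congr (_ + _); exact: addrC.
Qed.

(** Each factor pushes the last nonzero entry down by one place and multiplies it by a subdiagonal
    entry of S. The shifts sit on the diagonal and cannot affect this entry, so it is nonzero for
    all shifts. *)
Lemma shift_prod_evec1 (R : realType) n (S : 'M[R]_n) lambda N :
  upper_band 1 S ->
  (forall a b : 'I_n, a = b.+1 :> nat -> S a b != 0) ->
  (N < n)%N -> forall a : 'I_n,
  ((N < a)%N -> (shift_prod S lambda N *m evec 1) a 0 = 0) /\
  (a = N :> nat -> (shift_prod S lambda N *m evec 1) a 0 != 0).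
Proof.
move=> Sb Ss; elim: N => [|N IH] Nn a.
  rewrite shift_prod0 mul1mx mxE eqSS; split=> [|->]; last exact: oner_neq0.
  by case: (a : nat).
have {}IH := IH (ltnW Nn).
rewrite shift_prodS -mulmxA; set w := shift_prod _ _ _ *m _ in IH *.
(* In a row below N only the column N can contribute: later entries of [w] vanish, and earlier
   columns lie outside the band. *)
have wE (c : 'I_n) : (N < a)%N -> c != N :> nat ->
    (S - (lambda N.+1 ^+ 2)%:M) a c * w c 0 = 0.
  move=> Na cN; have [Nc|cN'] := ltnP N c; first by rewrite (IH c).1 ?mulr0.
  rewrite !mxE Sb; last by lia.
  by case: eqP => [e|_]; [rewrite e in Na; lia | rewrite subr0 mul0r].
split=> Na.
  rewrite mxE big1 // => c _.
  have [cN|cN] := eqVneq (c : nat) N; last by apply: wE => //; lia.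
  rewrite !mxE Sb; last by lia.
  by case: eqP => [e|_]; [rewrite e in Na; lia | rewrite subr0 mul0r].
pose b : 'I_n := Ordinal (ltnW Nn).
rewrite mxE (bigD1 b) //= big1 ?addr0 => [|c cb]; last by apply: wE; rewrite ?Na.
rewrite mulf_neq0 ?(IH b).2 //.
rewrite !mxE; case: (a =P b) => [e|_]; first by move: Na; rewrite e /=; lia.
by rewrite subr0 Ss.
Qed.

(** The residual x e_n^T is seen only by vectors with a nonzero last entry, and with N < n no factor
    is ever applied to such a vector. *)
Lemma shift_prod_krylov (R : realType) m n (M : 'M[R]_m) (W : 'M[R]_(m, n))
    (S : 'M[R]_n) (x : 'cV[R]_m) lambda N :
  M *m W = W *m S + x *m (evec n)^T ->
  upper_band 1 S -> (forall a b : 'I_n, a = b.+1 :> nat -> S a b != 0) ->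
  (N < n)%N ->
  shift_prod M lambda N *m (W *m evec 1) = W *m (shift_prod S lambda N *m evec 1).
Proof.
move=> MW Sb Ss; elim: N => [|N IH] Nn; first by rewrite !shift_prod0 !mul1mx.
rewrite !shift_prodS -!mulmxA {}IH 1?ltnW //.
set w := shift_prod S lambda N *m _.
have w0 : (evec n)^T *m w = 0.
  apply/matrixP => i j; rewrite !ord1 mxE [RHS]mxE big1 // => c _.
  rewrite [X in X * _]mxE [evec n c _]mxE; case: eqP => [cn|_]; last by rewrite mul0r.
  by rewrite (shift_prod_evec1 lambda Sb Ss (ltnW Nn) c).1 ?mulr0 //; lia.
rewrite mulmxA mulmxBl MW mulmxBl mulmxDl -(mulmxA x) w0 mulmx0 addr0.
by rewrite mulmxBl mulmxBr !mulmxA mul_scalar_mx mul_mx_scalar.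
Qed.

(** With G the product of the first j rotations, the current Gram matrix is G^T B B^T G. Hence (B
    B^T - lambda^2 I) G e_1 is G times what the next step does to e_1, and tau is the product of the
    factors gamma. *)
Lemma qr_steps_shift_prod (R : realType) k N lambda (B : 'M[R]_(k.+1, k)) Bb
    Gs Ps Gbs : (0 < k)%N -> lower_bidiagonal B -> upper_band 0 Bb ->
  qr_steps N lambda B Bb Gs Ps Gbs ->
  exists tau, shift_prod (B *m B^T) lambda N *m evec 1 =
    tau *: (\prod_(1 <= i < N.+1) Gs i *m evec 1).
Proof.
move=> k0 Bl Bu steps.
have shape := qr_steps_shape k0 Bl Bu steps.
have stepP i (iN : (1 <= i <= N)%N) :=
  let sh := shape i.-1 (leq_trans (leq_pred i) (andP iN).2) in
  qr_stepP k0 sh.1 sh.2 (steps i iN).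
suff: forall j, (j <= N)%N ->
    exists tau, shift_prod (B *m B^T) lambda j *m evec 1 =
      tau *: (\prod_(1 <= i < j.+1) Gs i *m evec 1) by apply.
elim=> [|j IH] jN.
  by exists 1; rewrite shift_prod0 big_geq // scale1r.
have [tau IHE] := IH (ltnW jN).
have [_ _ _ _ [gamma]] := stepP j.+1 jN.
rewrite qr_pairE /= => gE; exists (tau * gamma).
set G := \prod_(1 <= i < j.+1) Gs i in IHE gE *.
set P := \prod_(1 <= i < j.+1) Ps i in gE.
have PP : P *m P^T = 1%:M.
  apply/mulmx1C/prod_orth => i ij.
  by have [[]] := stepP i ltac:(lia).
have GG : G *m G^T = 1%:M.
  apply/mulmx1C/prod_orth => i ij.
  by have [[]] := stepP i ltac:(lia).
rewrite shift_prodS -mulmxA IHE big_nat_recr //= -mulmxE -/G -!scalemxAr.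
rewrite -scalerA -(mulmxA G) (scalemxAr _ G) -gE mulmxA; congr (_ *: _).
rewrite (mulmxA G); congr (_ *m _).
rewrite mulmxBl mulmxBr mul_scalar_mx mul_mx_scalar; congr (_ - _).
rewrite !trmx_mul trmxK !mulmxA GG mul1mx.
by rewrite -!mulmxA; congr (B *m _); rewrite [P *m _]mulmxA PP mul1mx.
Qed.

(** * Bidiagonal shape from a tridiagonal Gram matrix *)

(** Strong induction on the row a: in the sum for (M^T M)_{ab} the terms c > a vanish by
    triangularity and the terms c < a by induction. What is left is M_{aa} M_{ab} = 0, with M_{aa}
    nonzero by invertibility. *)
Lemma upper_bidiagonal_of_gram (R : realType) n (M : 'M[R]_n) :
  upper_band 0 M -> M \in unitmx ->
  (forall a b : 'I_n, (a.+1 < b)%N -> (M^T *m M) a b = 0) ->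
  upper_bidiagonal M.
Proof.
move=> Mu; rewrite unitmxE -det_tr det_trig; last first.
  by apply/is_trig_mxP => a b ab; rewrite mxE Mu ?addn0.
rewrite unitfE prodf_seq_neq0 => /allP diag gram a b ab ba.
have [lt_ab|le_ba] := ltnP a.+1 b; last by apply: Mu; lia.
elim: {a}_.+1 {-2}a (ltnSn a) b lt_ab {ab ba} => // q IH a aq b ab.
have := gram a b ab; rewrite mxE (bigD1 a) //= big1 => [|c ca].
  move/eqP; rewrite addr0 mulf_eq0 => /orP[|/eqP//].
  by have := diag a (mem_index_enum a); rewrite /= mxE => /negPf->.
rewrite mxE; have [lt_ca|le_ac] := ltnP c a.
  by rewrite (IH c _ b) ?mulr0 //; lia.
rewrite Mu ?mul0r //.
by move: ca; rewrite -val_eqE /=; lia.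
Qed.

(** * Truncation to leading columns *)

Lemma mulmx_lead (R : realType) m n r q (hq : (q <= n)%N) (M : 'M[R]_(m, n))
    (X : 'M[R]_(n, r)) :
  (forall (a : 'I_n) b, (q <= a)%N -> X a b = 0) ->
  M *m X = lead_cols hq M *m lead_mx hq (leqnn r) X.
Proof.
move=> X0; apply/matrixP => a b; rewrite !mxE.
rewrite (bigID (fun c : 'I_n => (c < q)%N)) /= addrC big1 => [|c]; last first.
  by rewrite -leqNgt => /X0->; rewrite mulr0.
rewrite add0r [RHS](eq_bigr (fun c => M a (widen_ord hq c) * X (widen_ord hq c) b)).
  by rewrite (big_ord_narrow hq).
move=> c _; rewrite !mxE; congr (_ * X _ _); exact/val_inj.
Qed.

(** The lone entry outside the leading rows is split off as a rank-one term. It supplies the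
    v_{l+1}^+ parts of the residuals. *)
Lemma mulmx_lead_last (R : realType) m n r q (hq : (q < n)%N) (M : 'M[R]_(m, n))
    (X : 'M[R]_(n, r)) :
  (forall (a : 'I_n) (b : 'I_r), (q <= a)%N -> (a != q :> nat) || (b.+1 != r) ->
    X a b = 0) ->
  M *m X = lead_cols (ltnW hq) M *m lead_mx (ltnW hq) (leqnn r) X
           + entry X q.+1 r *: (M *m evec q.+1) *m (evec r)^T.
Proof.
move=> X0; pose E : 'M[R]_(n, r) := evec q.+1 *m (evec r)^T.
have EE a b : E a b = (a.+1 == q.+1)%:R * (b.+1 == r)%:R.
  by rewrite !mxE big_ord1 !mxE.
(* The rank-one term lives in row q+1, so subtracting it does not change the first q rows. *)
have -> : lead_mx (ltnW hq) (leqnn r) X =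
    lead_mx (ltnW hq) (leqnn r) (X - entry X q.+1 r *: E).
  apply/matrixP => a b; rewrite 3!mxE [X in _ + X]mxE [X in _ - X]mxE EE /=.
  by rewrite eqSS ltn_eqF ?mul0r ?mulr0 ?subr0.
rewrite -mulmx_lead => [|a b qa].
  by rewrite mulmxBr -scalemxAr -scalemxAl -mulmxA subrK.
rewrite mxE [X in _ + X]mxE [X in _ - X]mxE EE eqSS.
have [aq|naq] := eqVneq (a : nat) q; last by rewrite X0 ?naq // mul0r mulr0 subr0.
have [br|nbr] := eqVneq b.+1 r; last by rewrite X0 ?nbr ?orbT // !mulr0 subr0.
by rewrite (@entryE _ _ _ _ _ _ a b) ?aq // !mulr1 subrr.
Qed.

Lemma lead_cols_mulmx (R : realType) m n r q (hq : (q <= r)%N) (M : 'M[R]_(m, n))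
    (X : 'M[R]_(n, r)) : lead_cols hq (M *m X) = M *m lead_cols hq X.
Proof. by apply/matrixP => a b; rewrite !mxE; apply: eq_bigr => c _; rewrite !mxE. Qed.

Lemma lead_mx_cols (R : realType) m n p q (hp : (p <= m)%N) (hq : (q <= n)%N)
    (M : 'M[R]_(m, n)) :
  lead_mx hp (leqnn q) (lead_cols hq M) = lead_mx hp hq M.
Proof. by apply/matrixP => a b; rewrite !mxE; congr (M _ _); exact/val_inj. Qed.

Lemma trmx_lead_mx (R : realType) m n p q (hp : (p <= m)%N) (hq : (q <= n)%N)
    (M : 'M[R]_(m, n)) : (lead_mx hp hq M)^T = lead_mx hq hp M^T.
Proof. by apply/matrixP => a b; rewrite !mxE. Qed.

Lemma tr_lead_cols_mulmx (R : realType) m n r q (hq : (q <= n)%N)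
    (M : 'M[R]_(m, n)) (Y : 'M[R]_(m, r)) :
  (lead_cols hq M)^T *m Y = rowsub (widen_ord hq) (M^T *m Y).
Proof. by apply/matrixP => a b; rewrite !mxE; apply: eq_bigr => c _; rewrite !mxE. Qed.

Lemma lead_cols_orth (R : realType) m n q (hq : (q <= n)%N) (M : 'M[R]_(m, n)) :
  orthonormal_cols M -> orthonormal_cols (lead_cols hq M).
Proof.
move=> Mo; rewrite /orthonormal_cols tr_lead_cols_mulmx -lead_cols_mulmx Mo.
by apply/matrixP => a b; rewrite !mxE.
Qed.

Lemma lead_cols_orth_next (R : realType) m n q (hq : (q <= n)%N) (M : 'M[R]_(m, n)) :
  orthonormal_cols M -> (lead_cols hq M)^T *m (M *m evec q.+1) = 0.
Proof.
move=> Mo; rewrite tr_lead_cols_mulmx mulmxA Mo mul1mx.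
by apply/matrixP => a b; rewrite !mxE /= eqSS ltn_eqF.
Qed.

Lemma lead_cols_evec1 (R : realType) m n q (hq : (q <= n)%N) (M : 'M[R]_(m, n)) :
  (0 < q)%N -> lead_cols hq M *m evec 1 = M *m evec 1.
Proof.
move=> q0; pose a : 'I_q := Ordinal q0.
rewrite (@mulmx_evec _ _ _ _ _ a) // (@mulmx_evec _ _ _ _ _ (widen_ord hq a)) //.
by apply/matrixP => c d; rewrite !mxE.
Qed.

(** In the last row, n - q subdiagonals reach back exactly to column q, so a residual multiplied by
    this row survives truncation in the last column only. *)
Lemma last_row_upper_band (R : realType) n q (hq : (q <= n)%N) (G : 'M[R]_n) :
  (0 < q)%N -> upper_band (n - q) G ->
  lead_cols hq ((evec n)^T *m G) = entry G n q *: (evec q)^T.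
Proof.
case: n hq G => [|n] hq G q0 Gb; first by lia.
apply/matrixP => i b; rewrite !ord1 !mxE.
rewrite (bigD1 ord_max) //= big1 => [|c]; last first.
  by rewrite -val_eqE /= => cn; rewrite !mxE eqSS (negPf cn) mul0r.
rewrite !mxE eqxx mul1r addr0; have [bq|bq] := eqVneq b.+1 q.
  by rewrite mulr1; symmetry; apply: entryE.
by rewrite mulr0 Gb //=; have := ltn_ord b; lia.
Qed.

(** * Passing from B B^T to B^T B *)

(** The first row of B holds only its diagonal entry. This trades the e_1 of length k+1 for that of
    length k. *)
Lemma tr_lower_bidiagonal_evec1 (R : realType) k (B : 'M[R]_(k.+1, k)) :
  (0 < k)%N -> lower_bidiagonal B -> B^T *m evec 1 = entry B 1 1 *: evec 1.
Proof.
move=> k0 Bl; rewrite (@mulmx_evec _ _ _ _ _ ord0) //.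
apply/colP => a; rewrite [LHS]mxE [LHS]mxE [RHS]mxE.
have [a0|a0] := posnP a.
  by rewrite mxE a0 mulr1; symmetry; apply: entryE; rewrite ?a0.
by rewrite evec1_eq0 // mulr0 Bl //=; lia.
Qed.

Lemma shift_prod_intertwine (R : realType) m n (B : 'M[R]_(m, n)) lambda N :
  shift_prod (B^T *m B) lambda N *m B^T = B^T *m shift_prod (B *m B^T) lambda N.
Proof.
elim: N => [|N IH]; first by rewrite !shift_prod0 mul1mx mulmx1.
rewrite !shift_prodS -mulmxA IH !mulmxA; congr (_ *m _).
by rewrite mulmxBl mulmxBr mul_scalar_mx mul_mx_scalar mulmxA.
Qed.

(** * Gram matrices of the lower bidiagonal matrix *)

Lemma lower_bidiag_mxP (R : realType) k (alpha beta : nat -> R) :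
  lower_bidiagonal (lower_bidiag_mx k alpha beta).
Proof. by move=> a b /negPf ab /negPf ab1; rewrite mxE ab ab1. Qed.

Lemma gram_tr_upper_band (R : realType) k (B : 'M[R]_(k.+1, k)) :
  lower_bidiagonal B -> upper_band 1 (B *m B^T).
Proof.
move=> Bl a b ab; rewrite mxE big1 // => c _; rewrite [_^T _ _]mxE.
have [e|ne] := boolP ((a == c :> nat) || (a == c.+1 :> nat)).
  by rewrite (Bl b) ?mulr0 //; lia.
by rewrite Bl ?mul0r //; lia.
Qed.

Lemma gram_upper_band (R : realType) k (B : 'M[R]_(k.+1, k)) :
  lower_bidiagonal B -> upper_band 1 (B^T *m B).
Proof.
move=> Bl a b ab; rewrite mxE big1 // => c _; rewrite [_^T _ _]mxE.
have [e|ne] := boolP ((c == a :> nat) || (c == a.+1 :> nat)).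
  by rewrite (Bl _ b) ?mulr0 //; lia.
by rewrite Bl ?mul0r //; lia.
Qed.

(** Rows b and b+1 (0-based) overlap in column b only, which gives alpha_{b+1} beta_{b+2}. *)
Lemma gram_tr_subdiag (R : realType) k (alpha beta : nat -> R)
    (B := lower_bidiag_mx k alpha beta) :
  (forall i, (1 <= i <= k.+1)%N -> 0 < alpha i) ->
  (forall i, (2 <= i <= k.+1)%N -> 0 < beta i) ->
  forall a b : 'I_k.+1, a = b.+1 :> nat -> (B *m B^T) a b != 0.
Proof.
move=> alpha_gt0 beta_gt0 a b ab; have Bl := @lower_bidiag_mxP R k alpha beta.
have bk : (b < k)%N by have := ltn_ord a; lia.
rewrite mxE (bigD1 (Ordinal bk)) //= big1 => [|c]; last first.
  rewrite -val_eqE /= => cb; rewrite [_^T _ _]mxE.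
  have [e|ne] := boolP (b == c.+1 :> nat).
    by rewrite Bl ?mul0r //; lia.
  by rewrite (Bl b) ?mulr0 //; lia.
rewrite addr0 [_^T _ _]mxE !mxE /= ab eqxx gtn_eqF // eqxx.
by apply: mulf_neq0; apply: lt0r_neq0; [apply: beta_gt0 | apply: alpha_gt0]; lia.
Qed.

(** Columns b and b+1 (0-based) overlap in row b+1 only, which gives alpha_{b+2} beta_{b+2}. *)
Lemma gram_subdiag (R : realType) k (alpha beta : nat -> R)
    (B := lower_bidiag_mx k alpha beta) :
  (forall i, (1 <= i <= k.+1)%N -> 0 < alpha i) ->
  (forall i, (2 <= i <= k.+1)%N -> 0 < beta i) ->
  forall a b : 'I_k, a = b.+1 :> nat -> (B^T *m B) a b != 0.
Proof.
move=> alpha_gt0 beta_gt0 a b ab; have Bl := @lower_bidiag_mxP R k alpha beta.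
have ak : (a < k.+1)%N by apply/leqW/ltn_ord.
rewrite mxE (bigD1 (Ordinal ak)) //= big1 => [|c]; last first.
  rewrite -val_eqE /= => ca; rewrite [_^T _ _]mxE.
  have [e|ne] := boolP (c == a.+1 :> nat).
    by rewrite (Bl _ b) ?mulr0 //; lia.
  by rewrite Bl ?mul0r //; lia.
rewrite addr0 [_^T _ _]mxE !mxE /= eqxx ab eqxx gtn_eqF //.
have := ltn_ord a; rewrite ab => bk.
by apply: mulf_neq0; apply: lt0r_neq0; [apply: alpha_gt0 | apply: beta_gt0]; lia.
Qed.

Lemma last_row_lower_bidiag_mx (R : realType) k (alpha beta : nat -> R) :
  (evec k.+1)^T *m lower_bidiag_mx k alpha beta = beta k.+1 *: (evec k)^T.
Proof.
apply/matrixP => i b; rewrite !ord1 mxE (bigD1 ord_max) //= big1 => [|c].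
  rewrite !mxE /= eqxx mul1r addr0 gtn_eqF // eq_sym.
  by case: eqP => [->|_]; rewrite ?mulr1 ?mulr0.
by rewrite -val_eqE /= => cn; rewrite !mxE eqSS (negPf cn) mul0r.
Qed.

(** * Consequences of the joint bidiagonalization *)

Lemma orthonormal_row_mx (R : realType) n k (V : 'M[R]_(n, k)) (v : 'cV[R]_n) :
  orthonormal_cols (row_mx V v) -> V^T *m V = 1%:M /\ V^T *m v = 0.
Proof.
rewrite /orthonormal_cols tr_row_mx mul_col_row scalar_mx_block.
by case/eq_block_mx.
Qed.

Lemma bar_mxE (R : realType) k (alphah betah : nat -> R) (a b : 'I_k) :
  (upper_bidiag_mx k alphah betah *m alt_diag_mx k) a b =
  upper_bidiag_mx k alphah betah a b * (-1) ^+ b.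
Proof. by rewrite mul_mx_diag [LHS]mxE [X in _ * X]mxE. Qed.

Lemma bar_mx_upper_band (R : realType) k (alphah betah : nat -> R) :
  upper_band 0 (upper_bidiag_mx k alphah betah *m alt_diag_mx k).
Proof.
move=> a b; rewrite addn0 => ab; rewrite bar_mxE mxE gtn_eqF // ltn_eqF ?mul0r //.
exact: leqW.
Qed.

Lemma bar_mx_unit (R : realType) k (alphah betah : nat -> R) :
  (forall i, (1 <= i <= k)%N -> 0 < alphah i) ->
  upper_bidiag_mx k alphah betah *m alt_diag_mx k \in unitmx.
Proof.
move=> ah_gt0; rewrite unitmxE -det_tr det_trig; last first.
  by apply/is_trig_mxP => a b ab; rewrite mxE bar_mx_upper_band ?addn0.
rewrite unitfE; apply/prodf_neq0 => a _.
rewrite mxE bar_mxE mulf_neq0 ?signr_eq0 // mxE eqxx.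
by apply/lt0r_neq0/ah_gt0; have := ltn_ord a.
Qed.

Lemma joint_lanczos_Vh (R : realType) m p n k (QA : 'M[R]_(m, n))
    (QL : 'M[R]_(p, n)) alpha beta alphah betah (U : 'M[R]_(m, k.+1)) V v
    (Uh : 'M[R]_(p, k)) Vh vh :
  joint_lanczos QA QL alpha beta alphah betah U V v Uh Vh vh ->
  Vh = V *m alt_diag_mx k.
Proof.
move=> J; apply/matrixP => a b; rewrite mul_mx_diag [RHS]mxE [X in _ * X]mxE mulrC.
have sgn : Vh *m evec b.+1 = (-1) ^+ b *: (V *m evec b.+1).
  have [b0|b0] := posnP b; first by rewrite b0 scale1r (jl_starth J).
  by apply: (jl_sign J); rewrite b0 /=.
by have /colP/(_ a) := sgn; rewrite !(@mulmx_evec _ _ _ _ _ b) // !mxE.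
Qed.

(** Substitute Vh = V D and use D^2 = I; the sign (-1)^k comes from [vh]. *)
Lemma joint_lanczos_bar (R : realType) m p n k (QA : 'M[R]_(m, n))
    (QL : 'M[R]_(p, n)) alpha beta alphah betah (U : 'M[R]_(m, k.+1)) V v
    (Uh : 'M[R]_(p, k)) Vh vh
    (Bb := upper_bidiag_mx k alphah betah *m alt_diag_mx k) :
  joint_lanczos QA QL alpha beta alphah betah U V v Uh Vh vh ->
  QL *m V = Uh *m Bb /\
  QL^T *m Uh = V *m Bb^T + ((-1) ^+ k * betah k) *: (v *m (evec k)^T).
Proof.
move=> J; have VhE := joint_lanczos_Vh J.
have DD : alt_diag_mx k *m alt_diag_mx k = 1%:M :> 'M[R]_k.
  apply/matrixP => a b; rewrite mul_mx_diag !mxE.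
  case: eqP => [->|_]; last by rewrite mulr0n mul0r.
  by rewrite /= -expr2 sqrr_sign.
split.
  have -> : V = Vh *m alt_diag_mx k by rewrite VhE -mulmxA DD mulmx1.
  by rewrite mulmxA (jl_L J) mulmxA.
rewrite (jl_LT J) (jl_sign_last J) VhE /Bb trmx_mul tr_diag_mx mulmxA.
by rewrite -scalemxAl scalerA mulrC.
Qed.

(** As U and Uh have orthonormal columns, the sum equals V^T (QA^T QA + QL^T QL) V = V^T V. *)
Lemma joint_lanczos_gram (R : realType) m p n k (QA : 'M[R]_(m, n))
    (QL : 'M[R]_(p, n)) alpha beta alphah betah (U : 'M[R]_(m, k.+1)) V v
    (Uh : 'M[R]_(p, k)) Vh vh
    (B := lower_bidiag_mx k alpha beta)
    (Bb := upper_bidiag_mx k alphah betah *m alt_diag_mx k) :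
  orthonormal_cols (col_mx QA QL) ->
  joint_lanczos QA QL alpha beta alphah betah U V v Uh Vh vh ->
  B^T *m B + Bb^T *m Bb = 1%:M.
Proof.
rewrite /orthonormal_cols tr_col_mx mul_row_col => QQ J.
have [LV _] := joint_lanczos_bar J; rewrite -/Bb in LV.
clearbody Bb; have [VV _] := orthonormal_row_mx (jl_V J).
have -> : B^T *m B = (QA *m V)^T *m (QA *m V).
  by rewrite (jl_A J) trmx_mul mulmxA -(mulmxA B^T) (jl_U J) mulmx1.
have -> : Bb^T *m Bb = (QL *m V)^T *m (QL *m V).
  by rewrite LV trmx_mul mulmxA -(mulmxA Bb^T) (jl_Uh J) mulmx1.
rewrite !trmx_mul !mulmxA -mulmxDl -!(mulmxA V^T) -mulmxDr QQ mulmx1.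
exact: VV.
Qed.

(** * The restarted processes *)

Theorem theorem4p6 (R : realType) (m p n k l : nat)
    (hmpn : (n <= m + p)%N) (hl : (1 <= l)%N) (hlk : (l < k)%N)
    (A : 'M[R]_(m, n)) (L : 'M[R]_(p, n))
    (hrank : \rank (col_mx A L) = n)
    (QA : 'M[R]_(m, n)) (QL : 'M[R]_(p, n)) (T : 'M[R]_n)
    (hQR : economy_QR A L QA QL T)
    (alpha beta alphah betah : nat -> R)
    (U : 'M[R]_(m, k.+1)) (V : 'M[R]_(n, k)) (v : 'cV[R]_n)
    (Uh : 'M[R]_(p, k)) (Vh : 'M[R]_(n, k)) (vh : 'cV[R]_n)
    (hJL : joint_lanczos QA QL alpha beta alphah betah U V v Uh Vh vh)
    (lambda mu : nat -> R)
    (hlambda : forall i : nat, (1 <= i <= k - l)%N -> 0 <= lambda i)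
    (hmu : forall i : nat, (1 <= i <= k - l)%N -> 0 <= mu i)
    (hshift : forall i : nat, (1 <= i <= k - l)%N ->
       lambda i ^+ 2 + mu i ^+ 2 = 1)
    (Gs : nat -> 'M[R]_k.+1) (Ps Gbs : nat -> 'M[R]_k)
    (hsteps : qr_steps (k - l) lambda
       (lower_bidiag_mx k alpha beta)
       (upper_bidiag_mx k alphah betah *m alt_diag_mx k)
       Gs Ps Gbs) :
  let B := lower_bidiag_mx k alpha beta in
  let Bb := upper_bidiag_mx k alphah betah *m alt_diag_mx k in
  let betab_k := (-1) ^+ k * betah k in
  let G := \prod_(1 <= i < (k - l).+1) Gs i in
  let P := \prod_(1 <= i < (k - l).+1) Ps i in
  let Gb := \prod_(1 <= i < (k - l).+1) Gbs i in
  let Bp := G^T *m B *m P in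
  let Vp := V *m P in
  let Up := U *m G in
  let Bbp := Gb^T *m Bb *m P in
  let Uhp := Uh *m Gb in
  let Vl := lead_cols (ltnW hlk) Vp in
  let Ul := lead_cols (leqW hlk) Up in
  let Uhl := lead_cols (ltnW hlk) Uhp in
  let Bl := lead_mx (leqW hlk) (ltnW hlk) Bp in
  let Bbl := lead_mx (ltnW hlk) (ltnW hlk) Bbp in
  let alphap := entry Bp l.+1 l.+1 in
  let betabp := entry Bbp l l.+1 in
  let vp := Vp *m evec l.+1 in
  let r := (alpha k.+1 * entry G k.+1 l.+1) *: v + alphap *: vp in
  let rb := (betab_k * entry Gb k l) *: v + betabp *: vp in
  let u1p := Ul *m evec 1 in
  let v1p := Vl *m evec 1 in
  [/\ [/\ QA *m Vl = Ul *m Bl,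
          QA^T *m Ul = Vl *m Bl^T + r *m (evec l.+1)^T,
          QL *m Vl = Uhl *m Bbl
        & QL^T *m Uhl = Vl *m Bbl^T + rb *m (evec l)^T],
      [/\ orthonormal_cols Ul, orthonormal_cols Vl & orthonormal_cols Uhl],
      [/\ lower_bidiagonal Bl, upper_bidiagonal Bbl,
          Vl^T *m r = 0 & Vl^T *m rb = 0],
      (exists tau : R, tau != 0 /\
         tau *: u1p =
           \prod_(1 <= i < (k - l).+1) (QA *m QA^T - (lambda i ^+ 2)%:M)
             *m (U *m evec 1))
    & (exists rho : R, rho != 0 /\
         rho *: v1p =
           \prod_(1 <= i < (k - l).+1) (QA^T *m QA - (lambda i ^+ 2)%:M)
             *m (V *m evec 1))].
Proof.
move=> B Bb betab_k G P Gb Bp Vp Up Bbp Uhp Vl Ul Uhl Bl Bbl alphap betabp vp.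
move=> r rb u1p v1p.
have k0 : (0 < k)%N := leq_trans hl (ltnW hlk).
have [Vo Vv] := orthonormal_row_mx (jl_V hJL).
have [LV LTU] := joint_lanczos_bar hJL.
have gram := joint_lanczos_gram (qr_orth hQR) hJL.
have Blow : lower_bidiagonal B by exact: lower_bidiag_mxP.
have Bbup : upper_band 0 Bb by exact: bar_mx_upper_band.
have Bbunit : Bb \in unitmx by apply: bar_mx_unit; exact: jl_alphah hJL.
have Sband := gram_tr_upper_band Blow; have Kband := gram_upper_band Blow.
have Ssub := gram_tr_subdiag (jl_alpha hJL) (jl_beta hJL).
have Ksub := gram_subdiag (jl_alpha hJL) (jl_beta hJL).
have alpha1 : entry B 1 1 != 0.
  rewrite (@entryE _ _ _ _ _ _ ord0 (Ordinal k0)) // mxE /=.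
  by apply: lt0r_neq0; apply: (jl_alpha hJL).
have Blast := last_row_lower_bidiag_mx k alpha beta.
have AV := jl_A hJL; have ATU := jl_AT hJL.
rewrite -/B -/Bb in hsteps AV ATU LV LTU gram Ssub Ksub Blast.
clearbody B Bb.
have shape := qr_steps_shape k0 Blow Bbup hsteps.
have stepP i (iN : (1 <= i <= k - l)%N) :=
  let sh := shape i.-1 (leq_trans (leq_pred i) (andP iN).2) in
  qr_stepP k0 sh.1 sh.2 (hsteps i iN).
have Go : G^T *m G = 1%:M by apply: prod_orth => i /stepP[[]].
have Po : P^T *m P = 1%:M by apply: prod_orth => i /stepP[[]].
have Gbo : Gb^T *m Gb = 1%:M by apply: prod_orth => i /stepP[[]].
have Gband : upper_band (k - l) G by apply: prod_upper_band => i /stepP[_ []].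
have Gbband : upper_band (k - l) Gb by apply: prod_upper_band => i /stepP[_ []].
have [] := shape _ (leqnn (k - l)); rewrite qr_pairE /= -/G -/P -/Gb -/Bp -/Bbp.
move=> Bplow Bbpup.
have GG := mulmx1C Go; have PP := mulmx1C Po; have GbGb := mulmx1C Gbo.
(* The relation B^T B + Bb^T Bb = I is conjugated by P, so the Gram matrix of [Bbp] is tridiagonal
   because that of [Bp] is. *)
have Bbpbi : upper_bidiagonal Bbp.
  apply: upper_bidiagonal_of_gram Bbpup _ _.
    rewrite !unitmx_mul unitmx_tr (mulmx1_unit Gbo).2 (mulmx1_unit Po).2.
    by rewrite Bbunit.
  move=> a b ab; have -> : Bbp^T *m Bbp = 1%:M - Bp^T *m Bp.
    apply/eqP; rewrite eq_sym subr_eq addrC; apply/eqP.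
    rewrite /Bp /Bbp !trmx_mul !trmxK !mulmxA.
    rewrite -(mulmxA _ G) GG mulmx1 -(mulmxA _ Gb) GbGb mulmx1.
    by rewrite -mulmxDl -!(mulmxA P^T) -mulmxDr gram mulmx1 Po.
  rewrite mxE [X in _ + X]mxE [X in X - _]mxE -val_eqE /= ltn_eqF ?(ltnW ab) //.
  rewrite sub0r -[_ *m _]trmxK mxE trmx_mul trmxK gram_upper_band ?oppr0 //.
  by rewrite addn1.
have Upo : orthonormal_cols Up.
  by rewrite /orthonormal_cols trmx_mul mulmxA -(mulmxA G^T) (jl_U hJL) mulmx1.
have Vpo : orthonormal_cols Vp.
  by rewrite /orthonormal_cols trmx_mul mulmxA -(mulmxA P^T) Vo mulmx1.
have Uhpo : orthonormal_cols Uhp.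
  by rewrite /orthonormal_cols trmx_mul mulmxA -(mulmxA Gb^T) (jl_Uh hJL) mulmx1.
have VpBp : V *m B^T *m G = Vp *m Bp^T.
  by rewrite /Vp /Bp !trmx_mul trmxK !mulmxA -(mulmxA V P) PP mulmx1.
have VpBbp : V *m Bb^T *m Gb = Vp *m Bbp^T.
  by rewrite /Vp /Bbp !trmx_mul trmxK !mulmxA -(mulmxA V P) PP mulmx1.
have [tau tauE] := qr_steps_shift_prod k0 Blow Bbup hsteps.
rewrite -/G in tauE.
(* After multiplication by alpha_1, the vector alpha_1 e_1 is B^T e_1. Moving B^T through the
   product gives tau B^T G e_1 = tau P Bp^T e_1, whose last factor is alpha_1^+ e_1. *)
have rhoE : shift_prod (B^T *m B) lambda (k - l) *m evec 1 =
    (tau * entry Bp 1 1 / entry B 1 1) *: (P *m evec 1).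
  apply: (scalerI alpha1); rewrite scalerA mulrCA divff // mulr1.
  rewrite scalemxAr -(tr_lower_bidiagonal_evec1 k0 Blow) mulmxA.
  rewrite shift_prod_intertwine -mulmxA tauE -scalemxAr -scalerA; congr (_ *: _).
  rewrite scalemxAr -(tr_lower_bidiagonal_evec1 k0 Bplow).
  by rewrite /Bp !trmx_mul trmxK !mulmxA PP mul1mx.
split.
- split.
  + rewrite -lead_cols_mulmx.
    have -> : QA *m Vp = Up *m Bp.
      by rewrite /Vp /Up /Bp !mulmxA -(mulmxA U G) GG mulmx1 AV.
    rewrite lead_cols_mulmx (mulmx_lead (leqW hlk)) ?lead_mx_cols // => a b la.
    by rewrite mxE Bplow //=; have := ltn_ord b; lia.
  + rewrite -lead_cols_mulmx mulmxA ATU mulmxDl VpBp.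
    rewrite -scalemxAl -mulmxA.
    have -> : lead_cols (leqW hlk)
        (Vp *m Bp^T + alpha k.+1 *: (v *m ((evec k.+1)^T *m G)))
      = lead_cols (leqW hlk) (Vp *m Bp^T)
        + alpha k.+1 *: (v *m lead_cols (leqW hlk) ((evec k.+1)^T *m G)).
      by rewrite -lead_cols_mulmx; apply/matrixP => a b; rewrite !mxE.
    (* Here (k+1) - (l+1) = k - l matches the bandwidth of G. *)
    rewrite last_row_upper_band ?subSS // lead_cols_mulmx.
    rewrite (mulmx_lead_last hlk) => [|a b la ab]; last first.
      by rewrite 2!mxE Bplow //=; have := ltn_ord b; lia.
    rewrite lead_mx_cols /Bl trmx_lead_mx -addrA; congr (_ + _).
    rewrite /r mulmxDl addrC -!scalemxAl -scalemxAr scalerA; congr (_ + _ *: _).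
    pose a := Ordinal hlk; pose b : 'I_l.+1 := ord_max.
    rewrite (@entryE _ _ _ _ _ _ a b) // /alphap.
    by rewrite (@entryE _ _ _ _ _ _ (widen_ord (leqW hlk) b) a) // !mxE.
  + rewrite -lead_cols_mulmx.
    have -> : QL *m Vp = Uhp *m Bbp.
      by rewrite /Vp /Uhp /Bbp !mulmxA -(mulmxA Uh Gb) GbGb mulmx1 LV.
    rewrite lead_cols_mulmx (mulmx_lead (ltnW hlk)) ?lead_mx_cols // => a b la.
    by rewrite mxE Bbpup //= addn0; have := ltn_ord b; lia.
  + rewrite -lead_cols_mulmx mulmxA LTU mulmxDl VpBbp.
    rewrite -scalemxAl -mulmxA.
    have -> : lead_cols (ltnW hlk) (Vp *m Bbp^T + betab_k *: (v *m ((evec k)^T *m Gb)))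
      = lead_cols (ltnW hlk) (Vp *m Bbp^T)
        + betab_k *: (v *m lead_cols (ltnW hlk) ((evec k)^T *m Gb)).
      by rewrite -lead_cols_mulmx; apply/matrixP => a b; rewrite !mxE.
    rewrite last_row_upper_band // lead_cols_mulmx.
    (* Triangularity of [Bbp] would not suffice here: the truncation leaves a single extra entry
       only because [Bbp] is bidiagonal. *)
    rewrite (mulmx_lead_last hlk) => [|a b la ab]; last first.
      by rewrite 2!mxE Bbpbi //=; have := ltn_ord b; lia.
    rewrite lead_mx_cols /Bbl trmx_lead_mx -addrA; congr (_ + _).
    rewrite /rb mulmxDl addrC -!scalemxAl -scalemxAr scalerA; congr (_ + _ *: _).
    have l1 : (l.-1 < l)%N by rewrite prednK.
    pose a := Ordinal hlk; pose b := Ordinal l1.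
    rewrite (@entryE _ _ _ _ _ _ a b) //= ?prednK // /betabp.
    by rewrite (@entryE _ _ _ _ _ _ (widen_ord (ltnW hlk) b) a) /= ?prednK // !mxE.
- by split; apply: lead_cols_orth.
- have Vlv : Vl^T *m v = 0.
    rewrite tr_lead_cols_mulmx /Vp trmx_mul -mulmxA Vv mulmx0.
    by apply/matrixP => a b; rewrite !mxE.
  have Vlvp : Vl^T *m vp = 0 by exact: lead_cols_orth_next.
  split.
  + by move=> a b ab ab1; rewrite mxE Bplow.
  + by move=> a b ab ab1; rewrite mxE Bbpbi.
  + by rewrite mulmxDr -!scalemxAr Vlv Vlvp !scaler0 addr0.
  + by rewrite mulmxDr -!scalemxAr Vlv Vlvp !scaler0 addr0.
- exists tau.
  have Nk : (k - l < k.+1)%N by rewrite ltnS leq_subr.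
  split.
    (* The 0-based entry k - l of the left side of [tauE] is nonzero, which excludes tau = 0. *)
    apply/eqP => tau0; have := (shift_prod_evec1 lambda Sband Ssub Nk (Ordinal Nk)).2.
    by rewrite tauE tau0 scale0r mxE eqxx => /(_ erefl).
  rewrite /u1p lead_cols_evec1 // -mulmxA scalemxAr -tauE.
  rewrite -(@shift_prod_krylov _ _ _ (QA *m QA^T) U (B *m B^T)
              (alpha k.+1 *: (QA *m v))) //.
  rewrite -mulmxA ATU mulmxDr mulmxA AV -mulmxA.
  by rewrite -scalemxAr -scalemxAl !mulmxA.
- exists (tau * entry Bp 1 1 / entry B 1 1).
  (* Length k leaves one index fewer than for tau; the strict bound comes from l >= 1. *)
  have Nk : (k - l < k)%N by rewrite ltn_subrL k0 hl.
  split.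
    apply/eqP => rho0; have := (shift_prod_evec1 lambda Kband Ksub Nk (Ordinal Nk)).2.
    by rewrite rhoE rho0 scale0r mxE eqxx => /(_ erefl).
  rewrite /v1p lead_cols_evec1 // -mulmxA scalemxAr -rhoE.
  (* The residual factor beta_{k+1} comes from the last row of B, which is beta_{k+1} e_k^T. *)
  rewrite -(@shift_prod_krylov _ _ _ (QA^T *m QA) V (B^T *m B)
              ((alpha k.+1 * beta k.+1) *: v)) //.
  rewrite -mulmxA AV mulmxA ATU mulmxDl -mulmxA; congr (_ + _).
  by rewrite -scalemxAl -mulmxA Blast -scalemxAr scalerA -scalemxAl.
Qed.
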